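(* Let $d\ge 2$, $\mu\in\mathbb S^{d-1}$, $\kappa>0$ and $\pi\in(0,1)$. Let $(z,Y)$ be a random pair with $z\in\mathbb S^{d-1}$ and $Y\in\{0,1\}$, such that $\Pr(Y=1)=\pi$, and the class-conditional densities of $z$ are $p(z\mid Y=1)=C_d(\kappa)\exp(\kappa\,\mu^\top z)$ and $p(z\mid Y=0)=U_d$. Then the Bayes-optimal classifier of $Y$ given $z$ is a threshold on the inner product $\mu^\top z$: it predicts $Y=1$ exactly when $$\mu^\top z\;\ge\;\tau:=-\frac1\kappa\left(\log C_d(\kappa)-\log U_d+\log\frac{\pi}{1-\pi}\right).$$
   Context: $\mathbb S^{d-1}=\{z\in\mathbb R^d:\|z\|_2=1\}$ is the unit sphere; all densities are with respect to surface measure on $\mathbb S^{d-1}$. $C_d(\kappa)>0$ is the normalizing constant making $z\mapsto C_d(\kappa)e^{\kappa\mu^\top z}$ a probability density (the von Mises--Fisher density with mean direction $\mu$ and concentration $\kappa$); it does not depend on $\mu$. $U_d$ is the constant density of the uniform distribution on $\mathbb S^{d-1}$, i.e. the reciprocal of its surface area. The Bayes-optimal classifier is the maximum a posteriori (MAP) rule, which minimizes the misclassification probability $\Pr(\hat y(z)\ne Y)$ over measurable $\hat y:\mathbb S^{d-1}\to\{0,1\}$: it predicts $1$ when $\log\frac{p(Y=1\mid z)}{p(Y=0\mid z)}\ge 0$ and $0$ otherwise (ties predicted as $1$). *)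

(* Defs.v *)
From HB Require Import structures.
From mathcomp Require Import all_boot all_order all_algebra.
From mathcomp Require Import all_classical all_reals all_analysis.
From mathcomp Require Import measurable_realfun.

Set Implicit Arguments.
Unset Strict Implicit.
Unset Printing Implicit Defensive.

Import Order.TTheory GRing.Theory Num.Theory.
Import numFieldNormedType.Exports.

Local Open Scope classical_set_scope.
Local Open Scope ring_scope.

(* Vectors of R^d are d-tuples: MathComp-Analysis equips [d.-tuple R] with the
   product sigma-algebra, i.e. the Borel sigma-algebra of R^d. *)

Section Euclidean.
Context {R : realType} {d : nat}.

Definition dot (x y : d.-tuple R) : R := \sum_(i < d) tnth x i * tnth y i.

Definition norm2 (x : d.-tuple R) : R := Num.sqrt (\sum_(i < d) tnth x i ^+ 2).

Definition sphere : set (d.-tuple R) := [set x | norm2 x = 1].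

Definition punctured_ball : set (d.-tuple R) := [set x | 0 < norm2 x <= 1].

Definition radial (x : d.-tuple R) : d.-tuple R :=
  [tuple tnth x i / norm2 x | i < d].

Lemma measurable_norm2 : measurable_fun [set: d.-tuple R] norm2.
Proof.
apply: (@measurableT_comp _ _ _ _ _ _ (@Num.sqrt R)).
  by apply: continuous_measurable_fun; exact: sqrt_continuous.
apply: measurable_sum => i; apply: measurable_funX; exact: measurable_tnth.
Qed.

Lemma measurable_punctured_ball : measurable punctured_ball.
Proof.
rewrite (_ : punctured_ball = norm2 @^-1` `]0, 1]); last first.
  by apply/seteqP; split => x; rewrite /= in_itv.
by rewrite -[X in measurable X]setTI; exact: measurable_norm2.
Qed.

Lemma measurable_radial : measurable_fun [set: d.-tuple R] radial.
Proof.
apply/measurable_fun_tnthP => i.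
rewrite (_ : _ \o _ = fun x => tnth x i * (norm2 x `^ (-1))); last first.
  by apply/funext => x /=; rewrite tnth_mktuple powR_inv1// sqrtr_ge0.
apply: measurable_funM; first exact: measurable_tnth.
apply: (@measurableT_comp _ _ _ _ _ _ (@powR R ^~ (-1))) => //.
exact: measurable_norm2.
Qed.

End Euclidean.
Arguments sphere : clear implicits.
Arguments punctured_ball : clear implicits.

Section Lebesgue.
Context {R : realType}.

Definition tcons n (p : R * n.-tuple R) : n.+1.-tuple R := [tuple of p.1 :: p.2].

Lemma measurable_tcons n : measurable_fun [set: R * n.-tuple R] (@tcons n).
Proof. by apply: measurable_cons. Qed.

Section step.
Local Open Scope ereal_scope.
Variables (n : nat) (m : {sigma_finite_measure set (n.-tuple R) -> \bar R}).

Definition lebesgue_step : set (n.+1.-tuple R) -> \bar R :=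
  pushforward (lebesgue_measure \x m) (@tcons n).

Let step0 : lebesgue_step set0 = 0.
Proof. by rewrite /lebesgue_step/pushforward preimage_set0 measure0. Qed.

Let step_ge0 A : 0 <= lebesgue_step A.
Proof. exact: (measure_ge0 (lebesgue_measure \x m)). Qed.

Let step_sigma_additive : semi_sigma_additive lebesgue_step.
Proof.
move=> F mF tF mUF; rewrite /lebesgue_step/pushforward preimage_bigcup.
apply: measure_semi_sigma_additive.
- by move=> k; rewrite -[X in measurable X]setTI; exact: measurable_tcons.
- apply/trivIsetP => /= i j _ _ ij; rewrite -preimage_setI.
  by move/trivIsetP : tF => /(_ _ _ _ _ ij) ->//; rewrite preimage_set0.
- by rewrite -preimage_bigcup -[X in measurable X]setTI; exact: measurable_tcons.
Qed.

HB.instance Definition _ := isMeasure.Build _ _ _ lebesgue_step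
  step0 step_ge0 step_sigma_additive.

Let step_sigma_finite : sigma_finite setT lebesgue_step.
Proof.
have /sigma_finiteP[F [TF ndF Foo]] :=
  sigma_finiteT (lebesgue_stieltjes_measure (@idfun R)).
have /sigma_finiteP[G [TG ndG Goo]] := sigma_finiteT m.
pose u (x : n.+1.-tuple R) : R * n.-tuple R := (thead x, [tuple of behead x]).
have mu : measurable_fun setT u.
  apply: measurable_fun_pair; [exact: measurable_tnth|exact: measurable_behead].
have uK p : u (tcons p) = p.
  by case: p => a t; congr pair; exact: val_inj.
exists (fun k => u @^-1` (F k `*` G k)) => [|k].
  apply/esym; rewrite -subTset => x _.
  have [i _ Fi] : (\bigcup_i F i) (thead x) by rewrite -TF.
  have [j _ Gj] : (\bigcup_i G i) [tuple of behead x] by rewrite -TG.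
  exists (maxn i j) => //; split => /=.
  - by move: Fi; exact/subsetPset/ndF/leq_maxl.
  - by move: Gj; exact/subsetPset/ndG/leq_maxr.
have [mF Fk] := Foo k; have [mG Gk] := Goo k.
split.
  rewrite -[X in measurable X]setTI; apply: mu => //; exact: measurableX.
rewrite /lebesgue_step /pushforward -comp_preimage.
rewrite (_ : u \o _ = id); last exact/funext.
by rewrite preimage_id product_measure1E// lte_mul_pinfty// ge0_fin_numE.
Qed.

HB.instance Definition _ := Measure_isSigmaFinite.Build _ _ _ lebesgue_step
  step_sigma_finite.

End step.

(* Lebesgue measure on R^n: the n-fold product of the one-dimensional one,
   transported along R * R^n ~ R^(n+1), starting from the unit mass on R^0. *)
Fixpoint lebesgue_tuple n : {sigma_finite_measure set (n.-tuple R) -> \bar R} :=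
  if n is n'.+1 then lebesgue_step (lebesgue_tuple n')
  else \d_([tuple] : 0.-tuple R).

End Lebesgue.
Arguments lebesgue_tuple : clear implicits.

Section Surface.
Local Open Scope ereal_scope.
Context {R : realType} {d : nat}.

(* Surface measure of S^(d-1): a Borel set A of the sphere has area d times the
   volume of the cone { r a | a in A, 0 < r <= 1 }, equivalently
   { x | 0 < ||x|| <= 1, x / ||x|| in A }.  (This is the measure sigma of the
   polar decomposition dx = r^(d-1) dr dsigma.)  It is a measure on R^d that is
   carried by the sphere. *)
Definition surface_measure (A : set (d.-tuple R)) : \bar R :=
  d%:R%:E * lebesgue_tuple R d (punctured_ball R d `&` radial @^-1` A).

Let surface0 : surface_measure set0 = 0.
Proof. by rewrite /surface_measure preimage_set0 setI0 measure0 mule0. Qed.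

Let surface_ge0 A : 0 <= surface_measure A.
Proof. by rewrite /surface_measure mule_ge0. Qed.

Let surface_sigma_additive : semi_sigma_additive surface_measure.
Proof.
have mR A : measurable A -> measurable (radial @^-1` A : set (d.-tuple R)).
  by move=> mA; rewrite -[X in measurable X]setTI; exact: measurable_radial.
move=> F mF tF mUF; rewrite [X in X @ \oo --> _](_ : _ = fun n =>
    d%:R%:E * \sum_(0 <= i < n)
      lebesgue_tuple R d (punctured_ball R d `&` radial @^-1` (F i))); last first.
  by apply/funext => k; rewrite ge0_sume_distrr.
apply: cvgeZl => //; rewrite preimage_bigcup setI_bigcupr.
apply: measure_semi_sigma_additive.
- move=> n; apply: measurableI; [exact: measurable_punctured_ball|exact: mR].
- apply/trivIset_setIl/trivIsetP => /= i j _ _ ij; rewrite -preimage_setI.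
  by move/trivIsetP : tF => /(_ _ _ _ _ ij) ->//; rewrite preimage_set0.
- rewrite -setI_bigcupr -preimage_bigcup; apply: measurableI.
    exact: measurable_punctured_ball.
  exact: mR.
Qed.

HB.instance Definition _ := isMeasure.Build _ _ _ surface_measure
  surface0 surface_ge0 surface_sigma_additive.

End Surface.

Section Model.
Context {R : realType} {d : nat}.

(* C_d(kappa).  The integral does not depend on mu, surface measure being
   rotation invariant; mu is an argument so that C_d(kappa) is literally the
   constant normalizing z |-> exp (kappa mu^T z). *)
Definition vmf_const (mu : d.-tuple R) (kappa : R) : R :=
  (\int[surface_measure]_(z in sphere R d) expR (kappa * dot mu z))^-1.

Definition vmf_density (mu : d.-tuple R) (kappa : R) (z : d.-tuple R) : R :=
  vmf_const mu kappa * expR (kappa * dot mu z).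

End Model.

Definition unif_const (R : realType) (d : nat) : R :=
  (fine (surface_measure (sphere R d)))^-1.

Section Classification.
Context {R : realType} {d : nat}.

Section pair.
Context {disp : measure_display} {Omega : measurableType disp}.
Variables (P : probability Omega R).
Variables (Z : {RV P >-> d.-tuple R}) (Y : {RV P >-> bool}).

Definition cond_prob (A B : set Omega) : R := fine (P (A `&` B)) / fine (P B).

(* Conditionally on Y = y, the variable Z (with values in the sphere) has
   density p with respect to surface measure. *)
Definition has_class_density (y : bool) (p : d.-tuple R -> R) : Prop :=
  forall A : set (d.-tuple R), measurable A -> A `<=` sphere R d ->
    ((cond_prob (Z @^-1` A) (Y @^-1` [set y]))%:E =
     \int[surface_measure]_(z in A) (p z)%:E)%E.

(* eta y z is a version of the conditional probability Pr(Y = y | Z = z). *)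
Definition is_posterior (eta : bool -> d.-tuple R -> R) : Prop :=
  forall y : bool, measurable_fun (sphere R d) (eta y) /\
    forall A : set (d.-tuple R), measurable A -> A `<=` sphere R d ->
      (P (Z @^-1` A `&` Y @^-1` [set y]) =
       \int[P]_(w in Z @^-1` A) (eta y (Z w))%:E)%E.

Definition misclassification (yhat : d.-tuple R -> bool) : \bar R :=
  P [set w | yhat (Z w) != Y w].

(* Classifiers are measurable functions on the sphere; their values off the
   sphere are irrelevant, since Z takes its values there. *)
Definition bayes_optimal (yhat : d.-tuple R -> bool) : Prop :=
  measurable_fun (sphere R d) yhat /\
  forall g : d.-tuple R -> bool, measurable_fun (sphere R d) g ->
    (misclassification yhat <= misclassification g)%E.

End pair.

(* p(Y = y | z) by Bayes' rule, from Pr(Y = 1) = prior and the class-conditional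
   densities p1 = p(. | Y = 1) and p0 = p(. | Y = 0). *)
Definition posterior (prior : R) (p1 p0 : d.-tuple R -> R)
    (y : bool) (z : d.-tuple R) : R :=
  (if y then prior * p1 z else (1 - prior) * p0 z) /
  (prior * p1 z + (1 - prior) * p0 z).

Definition map_classifier (eta : bool -> d.-tuple R -> R)
    (z : d.-tuple R) : bool :=
  0 <= ln (eta true z / eta false z).

End Classification.

(* Main.v *)
Require Import Defs.
From mathcomp Require Import all_boot all_order all_algebra.
From mathcomp Require Import all_classical all_reals all_analysis.
From mathcomp Require Import measurable_realfun lra.

(** Let [f y z] be the joint density of [(Z, Y)] at [(z, y)].  The law of [Z] has
    density [f true + f false], so [f y / (f true + f false)] is a posterior.
    The error probability of a classifier [g] is the integral of [f (~~ g z) z]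
    over the sphere, which is smallest when [g z] picks the larger of the two
    values pointwise.  The MAP rule does so, and for the von Mises-Fisher and
    uniform densities [ln (f true z) - ln (f false z)] is affine and increasing
    in [dot mu z]. *)

Import Order.TTheory GRing.Theory Num.Theory.
Import numFieldNormedType.Exports.

Local Open Scope classical_set_scope.
Local Open Scope ring_scope.

(** * Integration against a measure that has a density on a set *)

Section Density.
Local Open Scope ereal_scope.
Context {disp : measure_display} {T : measurableType disp} {R : realType}.
Variables (m nu : {measure set T -> \bar R}) (D : set T) (q : T -> R).
Hypotheses (mD : measurable D) (mq : measurable_fun D q).
Hypothesis q0 : forall x, D x -> (0 <= q x)%R.
Hypothesis nuE : forall A, measurable A -> A `<=` D ->
  nu A = \int[m]_(x in A) (q x)%:E.

Import HBNNSimple.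

(** Split [h] into multiples of indicators of its level sets; [nuE] evaluates [nu] on each level set
    cut down to [D]. *)
Let nnsfun_integral_density (h : {nnsfun T >-> R}) :
  \int[nu]_(x in D) (h x)%:E = \int[m]_(x in D) ((h x)%:E * (q x)%:E).
Proof.
have mi r : measurable_fun D (fun x => (r * \1_(h @^-1` [set r]) x)%:E).
  by apply: (measurable_comp measurableT) => //; exact: measurable_funM.
have hE x : (h x)%:E = \sum_(r \in range h) (r * \1_(h @^-1` [set r]) x)%:E.
  by rewrite fsumEFin// -fimfunE.
under eq_integral do rewrite hE.
rewrite ge0_integral_fsum//; last by move=> r x _; exact: nnfun_muleindic_ge0.
transitivity (\int[m]_(x in D) (\sum_(r \in range h)
    (r * \1_(h @^-1` [set r]) x)%:E * (q x)%:E)); last first.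
  apply: eq_integral => x _; rewrite hE -ge0_mule_fsuml// => r.
  exact: nnfun_muleindic_ge0.
rewrite ge0_integral_fsum//; last 2 first.
- by move=> r; apply: emeasurable_funM => //; exact/measurable_EFinP.
- by move=> r x Dx; rewrite mule_ge0 ?nnfun_muleindic_ge0// lee_fin q0.
apply: eq_fsbigr => r _.
have mhr : measurable (h @^-1` [set r]) by [].
rewrite integralZl_indic_nnsfun// integral_indic//.
under [RHS]eq_integral do rewrite EFinM -muleA.
(* For [r < 0] the level set is empty, so both sides vanish; for [r >= 0] the constant can be pulled
   out of the integral. *)
have [r0|r0] := ltP r 0%R.
  rewrite preimage_nnfun0// set0I measure0 indic0 mule0 integral0_eq// => x _.
  by rewrite mul0e mule0.
rewrite ge0_integralZl//; last 2 first.
- by apply: emeasurable_funM; exact/measurable_EFinP.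
- by move=> x Dx; rewrite mule_ge0// lee_fin ?q0.
rewrite nuE//; last exact: measurableI.
congr (_ * _); rewrite setIC integral_mkcondr; apply: eq_integral => x _.
by rewrite patchE indicE; case: ifP; rewrite ?mul1e ?mul0e.
Qed.

(** Monotone convergence on both sides, along simple functions increasing to [f]; since [q >= 0] on
    [D], their products with [q] increase as well. *)
Lemma ge0_integral_density (f : T -> \bar R) :
  measurable_fun D f -> (forall x, D x -> 0 <= f x) ->
  \int[nu]_(x in D) f x = \int[m]_(x in D) (f x * (q x)%:E).
Proof.
move=> mf f0; pose h := nnsfun_approx mD mf.
transitivity (limn (fun n => \int[nu]_(x in D) (h n x)%:E)).
  rewrite -monotone_convergence//.
  - apply: eq_integral => x /[!inE] Dx; apply/esym/cvg_lim => //.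
    exact: cvg_nnsfun_approx.
  - move=> n; exact/measurable_EFinP/measurable_funTS.
  - by move=> n x _; rewrite lee_fin.
  - by move=> x _ a b ab; rewrite lee_fin; exact/lefP/nd_nnsfun_approx.
under eq_fun do rewrite nnsfun_integral_density.
rewrite -monotone_convergence//.
- apply: eq_integral => x /[!inE] Dx; apply/cvg_lim => //.
  by apply: cvgeZr => //; exact: cvg_nnsfun_approx.
- move=> n; apply: emeasurable_funM; apply/measurable_EFinP => //.
  exact/measurable_funTS.
- by move=> n x Dx; rewrite mule_ge0// lee_fin ?q0.
- move=> x Dx a b ab; rewrite lee_wpmul2r ?lee_fin ?q0//.
  exact/lefP/nd_nnsfun_approx.
Qed.

End Density.

(** * Measurability on the sphere and signs of the normalizing constants *)

Section Sphere.
Context {R : realType} {d : nat}.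

Lemma measurable_sphere : measurable (sphere R d).
Proof.
rewrite (_ : sphere R d = norm2 @^-1` [set 1])//.
by rewrite -[X in measurable X]setTI; exact: measurable_norm2.
Qed.

Lemma measurable_dot (mu : d.-tuple R) : measurable_fun setT (dot mu).
Proof.
apply: measurable_sum => i; apply: measurable_funM => //.
exact: measurable_tnth.
Qed.

Lemma measurable_vmf_density (mu : d.-tuple R) (kappa : R) :
  measurable_fun setT (vmf_density mu kappa).
Proof.
apply: measurable_funM => //; apply: measurableT_comp => //.
by apply: measurable_funM => //; exact: measurable_dot.
Qed.

(** Only the weak inequality is immediate: an infinite integral would be sent to 0 by [fine], and
    the inverse of 0 is 0. Strict positivity will come from the total mass of the density. *)
Lemma vmf_const_ge0 (mu : d.-tuple R) (kappa : R) : 0 <= vmf_const mu kappa.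
Proof.
by rewrite invr_ge0 fine_ge0// integral_ge0// => z _; rewrite lee_fin expR_ge0.
Qed.

Lemma unif_const_ge0 : 0 <= unif_const R d.
Proof. by rewrite invr_ge0 fine_ge0. Qed.

End Sphere.

Lemma measurable_fun_pdiv {disp : measure_display} {T : measurableType disp}
    {R : realType} (D : set T) (f g : T -> R) :
  measurable_fun D f -> measurable_fun D g -> (forall x, D x -> 0 < g x) ->
  measurable_fun D (fun x => f x / g x).
Proof.
move=> mf mg g0; apply: measurable_funM => //.
(* Where [g] is positive, its inverse is the real power of exponent -1, and [powR] is measurable in
   its base. *)
apply: (eq_measurable_fun (fun x => g x `^ (-1))) => [x /[!inE] Dx|].
  by rewrite powR_inv1// ltW// g0.
by apply: (@measurableT_comp _ _ _ _ _ _ (@powR R ^~ (-1))).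
Qed.

(** * Posterior and error probability in terms of joint densities *)

Section Classifier.
Context {R : realType} {d : nat}.
Context {disp : measure_display} {Omega : measurableType disp}.
Variables (P : probability Omega R).
Variables (Z : {RV P >-> d.-tuple R}) (Y : {RV P >-> bool}).

Let mZ (A : set (d.-tuple R)) : measurable A -> measurable (Z @^-1` A).
Proof. by move=> mA; exact: measurable_funPTI. Qed.

Let mY (y : bool) : measurable (Y @^-1` [set y]).
Proof. exact: measurable_funPTI. Qed.

Lemma joint_of_class_density (y : bool) (p : d.-tuple R -> R) (c : R) :
  P (Y @^-1` [set y]) = c%:E -> 0 < c ->
  measurable_fun (sphere R d) p -> (forall z, sphere R d z -> 0 <= p z) ->
  has_class_density Z Y y p ->
  forall A, measurable A -> A `<=` sphere R d ->
  (P (Z @^-1` A `&` Y @^-1` [set y]) =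
   \int[surface_measure]_(z in A) (c * p z)%:E)%E.
Proof.
move=> Pc c0 mp p0 hp A mA AS.
under eq_integral do rewrite EFinM.
rewrite ge0_integralZl//; last 3 first.
- apply/measurable_EFinP; apply: measurable_funS mp => //.
  exact: measurable_sphere.
- by move=> z /AS /p0; rewrite lee_fin.
- by rewrite lee_fin ltW.
rewrite -hp// /cond_prob Pc -EFinM /= mulrC divfK ?gt_eqF// fineK//.
by rewrite fin_num_measure//; apply: measurableI; [exact: mZ|exact: mY].
Qed.

(** Take the whole sphere as [A]: its preimage under [Z] is all of [Omega], so the conditional
    probability is [c / c]. *)
Lemma integral_class_density (y : bool) (p : d.-tuple R -> R) (c : R) :
  (forall w, sphere R d (Z w)) ->
  P (Y @^-1` [set y]) = c%:E -> 0 < c -> has_class_density Z Y y p ->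
  (\int[surface_measure]_(z in sphere R d) (p z)%:E = 1)%E.
Proof.
move=> hZ Pc c0 /(_ _ measurable_sphere (@subset_refl _ _)) <-.
rewrite /cond_prob (_ : Z @^-1` _ = setT) ?setTI ?Pc /= ?divff ?gt_eqF//.
by apply/seteqP; split => // w _; exact: hZ.
Qed.

Hypothesis hZ : forall w, sphere R d (Z w).
Variable f : bool -> d.-tuple R -> R.
Hypothesis mf : forall y, measurable_fun (sphere R d) (f y).
Hypothesis f0 : forall y z, sphere R d z -> 0 < f y z.
Hypothesis fP : forall y A, measurable A -> A `<=` sphere R d ->
  (P (Z @^-1` A `&` Y @^-1` [set y]) =
   \int[surface_measure]_(z in A) (f y z)%:E)%E.

Let law_density A : measurable A -> A `<=` sphere R d ->
  (P (Z @^-1` A) =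
   \int[surface_measure]_(z in A) (f true z + f false z)%:E)%E.
Proof.
move=> mA AS; have mfA y : measurable_fun A (f y).
  by apply: measurable_funS (mf y) => //; exact: measurable_sphere.
under eq_integral do rewrite EFinD.
rewrite ge0_integralD//; last 4 first.
- by move=> z /AS /(f0 true) /ltW; rewrite lee_fin.
- exact/measurable_EFinP.
- by move=> z /AS /(f0 false) /ltW; rewrite lee_fin.
- exact/measurable_EFinP.
rewrite -!fP// -measureU.
- congr (P _); apply/seteqP; split => [w Aw|w [|]]; try by case.
  by case Yw : (Y w); [left|right].
- by apply: measurableI; [exact: mZ|exact: mY].
- by apply: measurableI; [exact: mZ|exact: mY].
- by apply/seteqP; split => // w [[_ /= ->] []].
Qed.

(** Moved to the law of [Z], the integral acquires the factor [f true + f false], which cancels the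
    denominator and leaves the integral of [f y]. *)
Lemma is_posterior_joint_density :
  is_posterior Z Y (fun y z => f y z / (f true z + f false z)).
Proof.
have q0 z : sphere R d z -> 0 < f true z + f false z.
  by move=> Sz; rewrite addr_gt0// f0.
have meta y : measurable_fun (sphere R d)
    (fun z => f y z / (f true z + f false z)).
  by apply: measurable_fun_pdiv => //; exact: measurable_funD.
move=> y; split => [//|A mA AS].
have sub (g : d.-tuple R -> R) : measurable_fun (sphere R d) g ->
    measurable_fun A g.
  by apply: measurable_funS => //; exact: measurable_sphere.
rewrite fP// -(@ge0_integral_pushforward _ _ _ _ R Z (measurable_funPT Z) P A
  (fun z => (f y z / (f true z + f false z))%:E))//; last 2 first.
- by apply/measurable_EFinP; exact: sub (meta y).
- move=> z /[!inE] /AS Sz; rewrite lee_fin divr_ge0// ltW ?q0//.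
  exact: f0.
rewrite (@ge0_integral_density _ _ _ surface_measure (distribution P Z) A
  (fun z => f true z + f false z))//.
- apply: eq_integral => z /[!inE] /AS Sz.
  by rewrite -EFinM divfK// gt_eqF// q0.
- by apply: measurable_funD; exact: sub.
- by move=> z /AS /q0 /ltW.
- by move=> B mB BA; rewrite -law_density//; exact: subset_trans AS.
- by apply/measurable_EFinP; exact: sub (meta y).
- by move=> z /AS Sz; rewrite lee_fin divr_ge0// ltW ?q0// f0.
Qed.

Let measurable_error (g : d.-tuple R -> bool) :
  measurable_fun (sphere R d) g ->
  measurable_fun (sphere R d) (fun z => f (~~ g z) z).
Proof.
move=> mg; rewrite (_ : (fun z => _) =
    (fun z => if g z then f false z else f true z)); last first.
  by apply/funext => z; case: (g z).
apply: measurable_fun_if => //; first exact: measurable_sphere.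
- apply: measurable_funS (mf false) => //; exact: measurable_sphere.
- apply: measurable_funS (mf true) => //; exact: measurable_sphere.
Qed.

(** Cut the sphere into [G true] and [G false]. On [G b] an error means that [Y] is [~~ b], an event
    whose probability [fP] gives as an integral of [f (~~ b)]. *)
Lemma misclassificationE (g : d.-tuple R -> bool) :
  measurable_fun (sphere R d) g ->
  (misclassification Z Y g =
   \int[surface_measure]_(z in sphere R d) (f (~~ g z) z)%:E)%E.
Proof.
move=> mg; pose G b := sphere R d `&` g @^-1` [set b].
have mG b : measurable (G b) by apply: mg => //; exact: measurable_sphere.
have GS b : G b `<=` sphere R d by exact: subIsetl.
have SE : sphere R d = G true `|` G false.
  apply/seteqP; split => [z Sz|z [|]]; try by case.
  by case gz : (g z); [left|right].
rewrite [in RHS]SE ge0_integral_setU//; last 3 first.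
- rewrite -SE; apply/measurable_EFinP; exact: measurable_error.
- by rewrite -SE => z Sz; rewrite lee_fin ltW// f0.
- rewrite disj_set2E; apply/eqP/seteqP; split => // z [[_ /= gz]] [_ /=].
  by rewrite gz.
rewrite (eq_integral (fun z => (f false z)%:E)); last first.
  by move=> z /[!inE] -[_ /= ->].
rewrite [X in (_ + X)%E](eq_integral (fun z => (f true z)%:E)); last first.
  by move=> z /[!inE] -[_ /= ->].
rewrite -!fP// -measureU.
- congr (P _); apply/seteqP; split => w /=; last by case=> -[[_ /= ->] ->].
  case gw : (g (Z w)); case Yw : (Y w) => // _; [left|right];
    by split => //; split => //=; exact: hZ.
- by apply: measurableI; [exact: mZ|exact: mY].
- by apply: measurableI; [exact: mZ|exact: mY].
- by apply/seteqP; split => // w [[_ /= Y1] [_ /=]]; rewrite Y1.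
Qed.

Lemma bayes_optimal_argmax (g : d.-tuple R -> bool) :
  measurable_fun (sphere R d) g ->
  (forall z, sphere R d z -> f (~~ g z) z <= f (g z) z) ->
  bayes_optimal Z Y g.
Proof.
move=> mg gmax; split=> // h mh; rewrite !misclassificationE//.
apply: ge0_le_integral => //.
- exact: measurable_sphere.
(* If [h z = g z] the integrands agree; otherwise that of [h] is [f (g z) z], the larger value. *)
- by move=> z Sz; rewrite lee_fin ltW// f0.
- apply/measurable_EFinP; exact: measurable_error.
- apply/measurable_EFinP; exact: measurable_error.
- move=> z Sz; rewrite lee_fin; have := gmax _ Sz.
  by case: (g z); case: (h z).
Qed.

End Classifier.

(** * The MAP rule and its threshold form *)

Lemma map_classifierE {R : realType} {d : nat}
    (eta : bool -> d.-tuple R -> R) (z : d.-tuple R) :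
  0 < eta true z -> 0 < eta false z ->
  map_classifier eta z = (eta false z <= eta true z).
Proof.
(* Positivity keeps the ratio where [ln] is strictly increasing, so the test compares the ratio with
   1. *)
move=> e1 e0; rewrite /map_classifier -ln1 ler_ln ?posrE ?divr_gt0//.
by rewrite ler_pdivlMr// mul1r.
Qed.

Theorem proposition4p1 (R : realType) (d : nat) (hd : (2 <= d)%N)
    (mu : d.-tuple R) (hmu : sphere R d mu)
    (kappa : R) (hkappa : 0 < kappa)
    (prior : R) (hprior : 0 < prior < 1)
    (disp : measure_display) (Omega : measurableType disp)
    (P : probability Omega R)
    (Z : {RV P >-> d.-tuple R}) (Y : {RV P >-> bool})
    (hZ : forall w : Omega, sphere R d (Z w))
    (hY : P (Y @^-1` [set true]) = prior%:E)
    (h1 : has_class_density Z Y true (vmf_density mu kappa))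
    (h0 : has_class_density Z Y false (fun=> unif_const R d)) :
  let eta := posterior prior (vmf_density mu kappa) (fun=> unif_const R d) in
  let tau := - (1 / kappa) *
    (ln (vmf_const mu kappa) - ln (unif_const R d) + ln (prior / (1 - prior))) in
  [/\ is_posterior Z Y eta,
      bayes_optimal Z Y (map_classifier eta) &
      forall z : d.-tuple R, sphere R d z ->
        (map_classifier eta z = true <-> tau <= dot mu z)].
Proof.
move=> eta tau; case/andP: hprior => prior0 prior1.
have nprior0 : 0 < 1 - prior by rewrite subr_gt0.
have hYN : P (Y @^-1` [set false]) = (1 - prior)%:E.
  rewrite (_ : _ @^-1` _ = ~` (Y @^-1` [set true])).
    by rewrite probability_setC ?hY//; exact: measurable_funPTI.
  by apply/seteqP; split => w /=; case: (Y w).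
(* A zero constant would contradict that the class-conditional densities have
   total mass 1; in particular the sphere has finite area. *)
have C0 : 0 < vmf_const mu kappa.
  rewrite lt_def vmf_const_ge0 andbT; apply/negP => /eqP C0.
  have := integral_class_density _ _ _ _ _ _ hZ hY prior0 h1.
  rewrite integral0_eq => [/eqP|z _]; first by rewrite eqe eq_sym oner_eq0.
  by rewrite /vmf_density C0 mul0r.
have U0 : 0 < unif_const R d.
  rewrite lt_def unif_const_ge0 andbT; apply/negP => /eqP U0.
  have := integral_class_density _ _ _ _ _ _ hZ hYN nprior0 h0.
  rewrite integral0_eq => [/eqP|z _]; first by rewrite eqe eq_sym oner_eq0.
  by rewrite U0.
have p10 z : 0 < vmf_density mu kappa z by rewrite mulr_gt0// expR_gt0.
pose f (y : bool) z : R := if y then prior * vmf_density mu kappa z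
  else (1 - prior) * unif_const R d.
have f0 y z : 0 < f y z by case: y; rewrite mulr_gt0.
have mf y : measurable_fun (sphere R d) (f y).
  case: y => //; apply: measurable_funM => //.
  by apply: measurable_funTS; exact: measurable_vmf_density.
have fP y A : measurable A -> A `<=` sphere R d ->
    (P (Z @^-1` A `&` Y @^-1` [set y]) =
     \int[surface_measure]_(z in A) (f y z)%:E)%E.
  case: y.
    apply: joint_of_class_density => // [|z _]; last exact: ltW.
    by apply: measurable_funTS; exact: measurable_vmf_density.
  by apply: joint_of_class_density => // z _; exact: ltW.
(* By unfolding, [eta y z] is [f y z] divided by [f true z + f false z]. *)
have etaP : is_posterior Z Y eta.
  by apply: (is_posterior_joint_density _ _ _ f) => // y z _; exact: f0.
have q0 z : 0 < f true z + f false z by rewrite addr_gt0.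
have etaE y z : eta y z = f y z / (f true z + f false z) by [].
have eta0 y z : 0 < eta y z by rewrite etaE divr_gt0.
have mapE z : map_classifier eta z = (f false z <= f true z).
  by rewrite map_classifierE// !etaE ler_pM2r// invr_gt0.
split => // [|z _].
- apply: (bayes_optimal_argmax _ _ _ hZ f) => //.
    rewrite (funext mapE); exact: measurable_fun_ler.
  by move=> z _; rewrite mapE; have [//|/ltW] := leP (f false z) (f true z).
- have lnf1 : ln (f true z) =
      ln prior + (ln (vmf_const mu kappa) + kappa * dot mu z).
    rewrite lnM ?posrE// [ln (vmf_density _ _ _)]lnM ?posrE ?expR_gt0//.
    by rewrite expRK.
  have lnf0 : ln (f false z) = ln (1 - prior) + ln (unif_const R d).
    by rewrite lnM ?posrE.
  rewrite mapE -ler_ln ?posrE// lnf1 lnf0 /tau.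
  rewrite (lnM (x := prior)) ?posrE ?invr_gt0// lnV ?posrE//.
  (* Multiplying by [kappa > 0] clears the factor [1 / kappa] of [tau]; both inequalities are then
     linear in the logarithms and the product of [kappa] and [dot mu z]. *)
  rewrite div1r mulNr -mulrN [kappa^-1 * _]mulrC ler_pdivrMr//.
  by split => ?; lra.
Qed.
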